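(* Let $\{\lambda_n\}$ be the spectrum of the Laplace operator on a Riemannian manifold, with eigenvalues repeated according to multiplicity. Let $N(\lambda)$ be the number of eigenvalues (with multiplicity) smaller than $\lambda$, and let $K(t)=\sum_{n}e^{-\lambda_n t}$. Let $\rho(\lambda)$ be the number of eigenstates per unit interval (the density of eigenstates). In the limit $\lambda\to\infty$ or $t\to0$, $$N(\lambda)=K\!\left(\frac1\lambda\right)\quad\text{or}\quad N\!\left(\frac1t\right)=K(t),$$ when $\rho(\lambda)$ is a constant.
   Context: $N(\lambda)$ is called the counting function and $K(t)$ the heat kernel (it is the heat trace). The result is presented as a case in which the counting function approximately equals the heat kernel. In the limit $\lambda\to\infty$ or $t\to0$, the sums over the spectrum are converted into integrals against the density of eigenstates: $N(\lambda)=\int_0^\lambda\rho(\lambda')\,d\lambda'$ and $K(t)=\int_0^\infty\rho(\lambda')e^{-\lambda' t}\,d\lambda'$. *)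

(* Defs.v *)
(* MathComp-Analysis: real analysis over an arbitrary R : realType. *)
From mathcomp Require Export all_boot all_order all_algebra finmap.
From mathcomp Require Export all_classical all_reals all_analysis.
Export Order.TTheory GRing.Theory Num.Theory.
Export numFieldNormedType.Exports.
#[global] Set Implicit Arguments.
#[global] Unset Strict Implicit.
#[global] Unset Printing Implicit Defensive.
#[global] Open Scope classical_set_scope.
#[global] Open Scope ring_scope.

Definition partial (R : realType) (d : nat) (i : 'I_d) (u : 'rV[R]_d -> R) :
  'rV[R]_d -> R := fun x => 'D_(delta_mx 0 i : 'rV[R]_d) u x.

(* C^k on a set U, meant for U open, so that the values of u outside U do not
   matter. *)
Fixpoint Ck_on (R : realType) (d : nat) (k : nat) (U : set 'rV[R]_d)
    (u : 'rV[R]_d -> R) : Prop :=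
  {in U, continuous u} /\
  if k is k'.+1 then
    forall i : 'I_d,
      {in U, forall x, derivable u x (delta_mx 0 i : 'rV[R]_d)} /\
      Ck_on k' U (partial i u)
  else True.

Definition smooth_on (R : realType) (d : nat) (U : set 'rV[R]_d)
    (u : 'rV[R]_d -> R) : Prop := forall k, Ck_on k U u.

(* A d-dimensional smooth atlas on M.  Chart i is the homeomorphism
   [chart_map i] from the open set [chart_dom i] onto the open set
   [chart_img i], with inverse [chart_inv i]; the values of these total
   functions elsewhere are irrelevant. *)
Record smooth_manifold (R : realType) (d : nat) (M : topologicalType) := {
  chart : Type;
  chart_dom : chart -> set M;
  chart_map : chart -> M -> 'rV[R]_d;
  chart_inv : chart -> 'rV[R]_d -> M;
  chart_at : M -> chart;
  chart_img := fun i => chart_map i @` chart_dom i;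
  manifold_hausdorff : hausdorff_space M;
  manifold_second_countable : @second_countable M;
  chart_at_dom : forall p, chart_dom (chart_at p) p;
  chart_dom_open : forall i, open (chart_dom i);
  chart_img_open : forall i, open (chart_img i);
  chart_mapK : forall i, {in chart_dom i, cancel (chart_map i) (chart_inv i)};
  chart_map_continuous : forall i, {in chart_dom i, continuous (chart_map i)};
  chart_inv_continuous : forall i, {in chart_img i, continuous (chart_inv i)};
  chart_transition_smooth : forall i j (k : 'I_d),
    smooth_on (chart_map i @` (chart_dom i `&` chart_dom j))
      (fun x => chart_map j (chart_inv i x) 0 k) }.

(* [metric i x] is the Gram matrix of the metric in the coordinates of chart i,
   at the point of coordinates x.  The library's Jacobian acts on row vectors
   (entry (a, b) is the derivative of component b along direction a), hence
   the form J g J^T of the change of coordinates. *)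
Record riemannian_manifold (R : realType) (d : nat) (M : topologicalType) := {
  manifold :> smooth_manifold R d M;
  metric : chart manifold -> 'rV[R]_d -> 'M[R]_d;
  metric_smooth : forall i (a b : 'I_d),
    smooth_on (@chart_img _ _ _ manifold i) (fun x => metric i x a b);
  metric_sym : forall i x, @chart_img _ _ _ manifold i x ->
    (metric i x)^T = metric i x;
  metric_pos : forall i x, @chart_img _ _ _ manifold i x ->
    forall v : 'rV[R]_d, v != 0 -> 0 < (v *m metric i x *m v^T) 0 0;
  metric_change : forall i j p, chart_dom i p -> chart_dom j p ->
    let x := chart_map i p in
    let J := jacobian (chart_map j \o @chart_inv _ _ _ manifold i) x in
    metric i x = J *m metric j (chart_map j p) *m J^T }.

Definition smooth_function (R : realType) (d : nat) (M : topologicalType)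
    (G : smooth_manifold R d M) (f : M -> R) : Prop :=
  forall i : chart G, smooth_on (chart_img i) (f \o chart_inv i).

Definition laplace_coord (R : realType) (d : nat) (g : 'rV[R]_d -> 'M[R]_d)
    (u : 'rV[R]_d -> R) (x : 'rV[R]_d) : R :=
  let s y := Num.sqrt (\det (g y)) in
  (s x)^-1 * \sum_(a < d) partial a
    (fun y => s y * \sum_(b < d) invmx (g y) a b * partial b u y) x.

(* The Laplace-Beltrami operator div grad; its value on a smooth function does
   not depend on the chart around p. *)
Definition laplacian (R : realType) (d : nat) (M : topologicalType)
    (G : riemannian_manifold R d M) (f : M -> R) : M -> R :=
  fun p => let i := chart_at G p in
    laplace_coord (metric i) (f \o chart_inv i) (chart_map i p).

(* A domain for the Laplace operator: a linear space of smooth functions, which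
   carries the boundary or integrability conditions, if any (Dirichlet or
   Neumann conditions when M is the interior of a manifold with boundary,
   square integrability when M is complete).  On a closed manifold it is the
   space of all smooth functions. *)
Definition laplace_domain (R : realType) (d : nat) (M : topologicalType)
    (G : riemannian_manifold R d M) (D : set (M -> R)) : Prop :=
  [/\ D `<=` smooth_function G,
      D (fun=> 0) &
      forall (a : R) (f g : M -> R), D f -> D g -> D (fun p => a * f p + g p)].

Definition eigenspace_laplace (R : realType) (d : nat) (M : topologicalType)
    (G : riemannian_manifold R d M) (D : set (M -> R)) (mu : R) :
    set (M -> R) :=
  [set f | D f /\ forall p, - laplacian G f p = mu * f p].

Definition has_dim (R : realType) (T : Type) (E : set (T -> R)) (k : nat) :
    Prop :=
  exists b : 'I_k -> T -> R, (forall i, E (b i)) /\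
    forall f, E f ->
      exists! a : 'rV[R]_k, forall p, f p = \sum_(i < k) a 0 i * b i p.

(* The sequence lam lists the eigenvalues of - laplacian, each one as many times
   as the dimension of its eigenspace, in any order; only finitely many of them
   lie below any given level. *)
Definition laplace_spectrum (R : realType) (d : nat) (M : topologicalType)
    (G : riemannian_manifold R d M) (D : set (M -> R)) (lam : nat -> R) :
    Prop :=
  (forall x, finite_set [set n | lam n < x]) /\
  (forall mu, has_dim (eigenspace_laplace G D mu)
                #|` fset_set [set n | lam n = mu]|).

Definition counting_function (R : realType) (lam : nat -> R) (x : R) : R :=
  #|` fset_set [set n | lam n < x]|%:R.

Definition heat_kernel (R : realType) (lam : nat -> R) (t : R) : R :=
  limn (series (fun n => expR (- lam n * t))).

(* The number of eigenvalues below x is, in the limit of large x, the integral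
   of the density. *)
Definition density_of_eigenstates (R : realType) (lam : nat -> R)
    (rho : R -> R) : Prop :=
  (forall x, (@lebesgue_measure R).-integrable `[0, x] (EFin \o rho)) /\
  counting_function lam x / (\int[@lebesgue_measure R]_(y in `[0, x]) rho y)%R
    @[x --> +oo%R] --> (1 : R).

(* Main.v *)
Require Import Defs.
From mathcomp Require Import ring lra.

(* The statement reduces to an Abelian theorem: since the density is a constant
   c, N(x) ~ c x, and it suffices that t K(t) --> c as t --> 0+.  With
   q = expR (- t), comparing each e^(- lam_n t) with q ^ floor(lam_n) and
   summing by parts gives, up to a factor tending to 1,
     K(t) = (1 - q) * \sum_j q^j N(j + 1),
   and N(j + 1) = c (j + 1) + o(j) turns the right-hand side into
   c / (1 - q) + o(1 / t). *)

(** * Counting functions as finite sums of indicators *)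

Section counting.
Context (R : realType) (lam : nat -> R).
Hypothesis finite_lam : forall x, finite_set [set n | lam n < x].

Let countE m (x : R) : \sum_(0 <= n < m) (lam n < x)%R%:R =
  (size [seq n <- index_iota 0 m | lam n < x])%:R :> R.
Proof.
rewrite size_filter -sum1_count [in RHS]big_mkcond natr_sum.
by apply: eq_bigr => n _; case: ltP.
Qed.

Lemma partial_count_le m (x : R) :
  \sum_(0 <= n < m) (lam n < x)%R%:R <= counting_function lam x.
Proof.
rewrite countE ler_nat; apply: uniq_leq_size.
  by rewrite filter_uniq// iota_uniq.
move=> n; rewrite mem_filter => /andP[nx _].
by rewrite in_fset_set// inE.
Qed.

(** An index counted at a level [y <= x] is also counted at [x], so one threshold serves all these
    levels: the successor of the largest index with [lam n < x]. *)
Lemma partial_count_eq (x : R) : exists m0, forall m y, (m0 <= m)%N -> y <= x ->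
  counting_function lam y = \sum_(0 <= n < m) (lam n < y)%R%:R.
Proof.
pose A := fset_set [set n | lam n < x].
exists (\max_(n <- A) n).+1 => m y Am yx.
apply/le_anti; rewrite partial_count_le andbT.
rewrite countE ler_nat; apply: uniq_leq_size; first exact: fset_uniq.
move=> n; rewrite in_fset_set// inE /= => ny.
rewrite mem_filter ny mem_index_iota /=.
apply: leq_trans Am; rewrite ltnS; apply: (leq_bigmax_seq (F := id)) => //.
by rewrite in_fset_set// inE /= (lt_le_trans ny).
Qed.

(** Only finitely many eigenvalues are negative, and the sum of their absolute values dominates each
    of them. *)
Lemma lam_bounded_below : exists2 L : R, 0 <= L & forall n, - L <= lam n.
Proof.
pose A := fset_set [set n | lam n < 0].
have AP n : n \in A = (lam n < 0).
  by rewrite in_fset_set//; apply/idP/idP; rewrite inE.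
exists (\sum_(n <- A) - lam n).
  by rewrite big_seq; apply: sumr_ge0 => n; rewrite AP oppr_ge0 => /ltW.
move=> n; have [n0|n0] := leP 0 (lam n).
  apply: (le_trans _ n0); rewrite oppr_le0.
  by rewrite big_seq; apply: sumr_ge0 => k; rewrite AP oppr_ge0 => /ltW.
rewrite lerNl (big_fsetD1 n) ?AP//= lerDl.
rewrite big_seq; apply: sumr_ge0 => k; rewrite !inE AP oppr_ge0.
by case/andP => _ /ltW.
Qed.

End counting.

(** * Geometric sums and powers with truncated exponents *)

Section powers.
Context (R : realType).
Implicit Types q x : R.

(* A truncated geometric tail; summed over a sequence of x's, it turns
   \sum q ^+ truncn x into a power series of counting functions.  A negative x
   has truncn x = 0 and is counted from j = 0 on. *)
Lemma expr_truncn q x J : (Num.truncn x <= J)%N ->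
  q ^+ Num.truncn x =
    (1 - q) * \sum_(0 <= j < J) q ^+ j * (x < j.+1%:R)%R%:R + q ^+ J.
Proof.
elim: J => [|J IH].
  by rewrite leqn0 => /eqP ->; rewrite big_nil mulr0 add0r.
rewrite leq_eqVlt => /predU1P[xJ|].
  rewrite xJ big1_seq ?mulr0 ?add0r// => j /andP[_].
  rewrite mem_index_iota -truncn_le_nat xJ => /ltn_geF ->.
  by rewrite mulr0.
rewrite ltnS => xJ; rewrite big_nat_recr//= -truncn_le_nat xJ mulr1.
by rewrite mulrDr [LHS]IH// exprS; ring.
Qed.

Lemma sum_geometric q J : (1 - q) * \sum_(0 <= j < J) q ^+ j = 1 - q ^+ J.
Proof.
elim: J => [|J IH]; first by rewrite big_nil mulr0 subrr.
by rewrite big_nat_recr//= mulrDr IH exprS; ring.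
Qed.

Lemma sum_arith_geometric q J :
  (1 - q) ^+ 2 * \sum_(0 <= j < J) q ^+ j * j.+1%:R =
  1 - q ^+ J - (1 - q) * (J%:R * q ^+ J).
Proof.
elim: J => [|J IH]; first by rewrite big_nil mulr0 mul0r mulr0 subr0 subrr.
by rewrite big_nat_recr//= mulrDr IH (exprS q J) -(natr1 J); ring.
Qed.

Lemma cvg_natr_expr t : 0 < t ->
  (n%:R * expR (- t) ^+ n) @[n --> \oo] --> (0 : R).
Proof.
move=> t0.
(* With r = e^(-t/2), the power splits as r^n r^n. One factor absorbs n, since e^(nt/2) >= nt/2
   gives n r^n <= 2/t; the other still tends to 0. *)
pose h n : R := (2 / t) * expR (- (t / 2)) ^+ n.
have h0 : h n @[n --> \oo] --> (0 : R).
  apply: cvg_geometric; rewrite ger0_norm ?expR_ge0//.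
  by rewrite expR_lt1 oppr_lt0 divr_gt0.
apply: (squeeze_cvgr _ (cvg_cst 0) h0); near=> n; apply/andP; split.
  by rewrite mulr_ge0// exprn_ge0// expR_ge0.
have -> : expR (- t) ^+ n = expR (- (t / 2)) ^+ n * expR (- (t / 2)) ^+ n.
  by rewrite -exprMn -expRD; congr (expR _ ^+ _); lra.
rewrite /h mulrA ler_wpM2r ?exprn_ge0 ?expR_ge0//.
rewrite -[X in _ * X <= _]invrK -exprVn -expRN opprK -expRM_natl.
rewrite ler_pdivrMr ?expR_gt0//.
have := expR_ge1Dx (n%:R * (t / 2)).
set y := expR _ => hy.
rewrite mulrAC ler_pdivlMr//; lra.
Unshelve. all: by end_near. Qed.

End powers.

(** * Two-sided bounds on the heat trace *)

Section heat.
Context (R : realType) (lam : nat -> R).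
Hypothesis finite_lam : forall x, finite_set [set n | lam n < x].

Let trunc_series q m : R := \sum_(0 <= n < m) q ^+ Num.truncn (lam n).

(** Summation by parts: expand each power by [expr_truncn] and exchange the two finite sums. For
    fixed [m] and 0 < q < 1 the remainder vanishes as [J] grows. *)
Let trunc_seriesE q m J :
  (forall n, (n < m)%N -> (Num.truncn (lam n) <= J)%N) ->
  trunc_series q m =
    (1 - q) * \sum_(0 <= j < J) q ^+ j *
      (\sum_(0 <= n < m) (lam n < j.+1%:R)%R%:R) + m%:R * q ^+ J.
Proof.
move=> lamJ; rewrite /trunc_series.
under eq_big_nat => n /andP[_ nm] do rewrite (@expr_truncn _ _ _ J) ?lamJ//.
rewrite big_split/= -mulr_sumr; congr (_ * _ + _).
  rewrite exchange_big_nat/=; apply: eq_bigr => j _.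
  by rewrite mulr_sumr.
by rewrite sumr_const_nat subn0 mulr_natl.
Qed.

Let trunc_bounded m : exists J0, forall J, (J0 <= J)%N ->
  forall n, (n < m)%N -> (Num.truncn (lam n) <= J)%N.
Proof.
exists (\max_(n < m) Num.truncn (lam n)) => J le_J n nm.
exact: leq_trans (leq_bigmax (Ordinal nm)) le_J.
Qed.

(** Rounding down costs the factor e^(Lt), because floor(lam n) - L <= lam n, also for negative
    eigenvalues, which truncate to 0. The bound is uniform in [m], so it will also yield convergence
    of the series. *)
Lemma heat_partial_sum_le (L c C t : R) m :
  0 < t -> 0 <= L -> 0 <= c -> 0 <= C ->
  (forall n, - L <= lam n) ->
  (forall j, counting_function lam j.+1%:R <= c * j.+1%:R + C) ->
  series (fun n => expR (- lam n * t)) m <=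
    expR (L * t) * (c / (1 - expR (- t)) + C).
Proof.
move=> t0 L0 c0 C0 leL leN; set q := expR (- t).
have q0 : 0 < q by exact: expR_gt0.
have q1 : q < 1 by rewrite expR_lt1 oppr_lt0.
have p0 : 0 < 1 - q by rewrite subr_gt0.
have pn0 : 1 - q != 0 by rewrite gt_eqF.
have leS : trunc_series q m <= c / (1 - q) + C.
  have qJ : c / (1 - q) + C + m%:R * q ^+ J @[J --> \oo] --> c / (1 - q) + C.
    rewrite -[X in _ --> X]addr0; apply: cvgD; first exact: cvg_cst.
    rewrite -(mulr0 m%:R); apply: cvgM; first exact: cvg_cst.
    by apply: cvg_expr; rewrite gtr0_norm.
  apply: (cvgr_to_ge qJ).
  have [J0 leJ] := trunc_bounded m.
  near=> J.
  rewrite (@trunc_seriesE _ _ J); last first.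
    by apply: leJ; near: J; exact: nbhs_infty_ge.
  rewrite lerD2r.
  apply: (@le_trans _ _
    ((1 - q) * \sum_(0 <= j < J) q ^+ j * (c * j.+1%:R + C))).
    rewrite ler_wpM2l ?(ltW p0)//; apply: ler_sum => j _.
    rewrite ler_wpM2l ?exprn_ge0 ?(ltW q0)//.
    exact: le_trans (partial_count_le finite_lam _ _) (leN j).
  have -> : (1 - q) * \sum_(0 <= j < J) q ^+ j * (c * j.+1%:R + C) =
    c / (1 - q) * ((1 - q) ^+ 2 * \sum_(0 <= j < J) q ^+ j * j.+1%:R) +
    C * ((1 - q) * \sum_(0 <= j < J) q ^+ j).
    under eq_bigr do rewrite mulrDr mulrCA [_ * C]mulrC.
    rewrite big_split/= -!mulr_sumr; field.
    exact: pn0.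
  rewrite sum_arith_geometric sum_geometric.
  have qJ0 : 0 <= q ^+ J by rewrite exprn_ge0 ?ltW.
  rewrite lerD//; apply: ler_piMr => //.
  - by rewrite divr_ge0 ?(ltW p0).
  - have : 0 <= (1 - q) * (J%:R * q ^+ J) by rewrite !mulr_ge0 ?(ltW p0).
    by lra.
  - by lra.
apply: le_trans (ler_wpM2l (expR_ge0 _) leS).
rewrite /series/= mulr_sumr; apply: ler_sum => n _.
rewrite -expRM_natl -expRD ler_expR.
rewrite (_ : _ + _ = (L - (Num.truncn (lam n))%:R) * t); last by ring.
rewrite ler_wpM2r ?(ltW t0)// lerNl opprB.
have [n0|n0] := leP 0 (lam n).
  by rewrite lerBlDr -[leLHS]addr0 lerD// truncn_le.
rewrite (_ : Num.truncn _ = 0%N) ?sub0r//.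
by apply/eqP; rewrite -leqn0 truncn_le_nat (lt_trans n0).
Unshelve. all: by end_near. Qed.

(** Since lam n < floor(lam n) + 1, the heat series dominates q times the truncated one. All terms
    are nonnegative, so a partial sum long enough to count correctly up to level [J] suffices; then
    [J] tends to infinity. *)
Lemma heat_kernel_ge (c C t : R) : 0 < t ->
  cvgn (series (fun n => expR (- lam n * t))) ->
  (forall j, c * j.+1%:R - C <= counting_function lam j.+1%:R) ->
  expR (- t) * (c / (1 - expR (- t)) - C) <= heat_kernel lam t.
Proof.
move=> t0 cvgK geN; set q := expR (- t).
have q0 : 0 < q by exact: expR_gt0.
have q1 : q < 1 by rewrite expR_lt1 oppr_lt0.
have p0 : 0 < 1 - q by rewrite subr_gt0.
have pn0 : 1 - q != 0 by rewrite gt_eqF.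
have nd_series : nondecreasing_seq (series (fun n => expR (- lam n * t))).
  by move=> a b ab; rewrite increasing_series// => n; exact: expR_gt0.
pose b J :=
  c / (1 - q) * (1 - q ^+ J - (1 - q) * (J%:R * q ^+ J)) - C * (1 - q ^+ J).
have bJ : q * b J @[J --> \oo] --> q * (c / (1 - q) - C).
  have qJ : q ^+ J @[J --> \oo] --> (0 : R).
    by apply: cvg_expr; rewrite gtr0_norm.
  apply: cvgM; first exact: cvg_cst.
  have -> : c / (1 - q) - C = c / (1 - q) * (1 - 0 - (1 - q) * 0) - C * (1 - 0).
    by rewrite mulr0 !subr0 !mulr1.
  apply: cvgB.
    apply: cvgM; first exact: cvg_cst.
    apply: cvgB; first by apply: cvgB => //; exact: cvg_cst.
    by apply: cvgM; [exact: cvg_cst | exact: cvg_natr_expr].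
  by apply: cvgM; [exact: cvg_cst | apply: cvgB => //; exact: cvg_cst].
apply: (cvgr_to_le bJ); near=> J.
have [m0 countJ] := partial_count_eq finite_lam J%:R.
have [J0 leJ] := trunc_bounded m0.
apply: le_trans (nondecreasing_cvgn_le nd_series cvgK m0).
apply: (@le_trans _ _ (q * trunc_series q m0)); last first.
  rewrite /series/= mulr_sumr; apply: ler_sum => n _.
  rewrite -expRM_natl -expRD ler_expR.
  rewrite (_ : _ + _ = - (Num.truncn (lam n)).+1%:R * t); last first.
    by rewrite -natr1; ring.
  by rewrite ler_wpM2r ?(ltW t0)// lerN2 ltW// truncnS_gt.
(* The cutoff must exceed the truncations of the first [m0] eigenvalues, hence [J + J0]; the levels
   from [J] on and the remainder are nonnegative and get dropped. *)
rewrite ler_pM2l// (@trunc_seriesE _ _ (J + J0)); last first.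
  by apply: leJ; rewrite leq_addl.
apply: ler_wpDr; first by rewrite mulr_ge0// exprn_ge0// ltW.
have -> : b J = (1 - q) * \sum_(0 <= j < J) q ^+ j * (c * j.+1%:R - C).
  rewrite /b -sum_arith_geometric -sum_geometric.
  under [in RHS]eq_bigr do rewrite mulrBr mulrCA [_ * C]mulrC.
  rewrite sumrB -!mulr_sumr; field.
  exact: pn0.
rewrite ler_pM2l// [leRHS](big_cat_nat (n := J)) ?leq_addr//=.
apply: ler_wpDr.
  apply: sumr_ge0 => j _; rewrite mulr_ge0 ?exprn_ge0 ?(ltW q0)//.
  by apply: sumr_ge0.
apply: ler_sum_nat => j /andP[_ jJ].
by rewrite ler_pM2l ?exprn_gt0// -countJ// ler_nat.
Unshelve. all: by end_near. Qed.

End heat.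

Lemma cvg_seq_linear_bound (R : realType) (a : nat -> R) (c e : R) : 0 < e ->
  a j / j.+1%:R @[j --> \oo] --> c ->
  exists2 C : R, 0 <= C & forall j, `|a j - c * j.+1%:R| <= e * j.+1%:R + C.
Proof.
move=> e0 /cvgrPdist_le/(_ e e0)[n0 _ near_a].
(* Beyond [n0] the slope error [e] is enough; the constant only has to cover the finitely many
   earlier deviations. *)
exists (\sum_(0 <= j < n0) `|a j - c * j.+1%:R|); first exact: sumr_ge0.
move=> j; have [n0j|jn0] := leqP n0 j.
  apply: ler_wpDr; first exact: sumr_ge0.
  have := near_a j n0j.
  rewrite distrC => /(ler_wpM2r (ler0n R j.+1)).
  by rewrite -[X in `|_| * X]ger0_norm// -normrM mulrBl mulfVK.
apply: ler_wpDl; first by rewrite mulr_ge0// ltW.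
rewrite big_mkord (bigD1 (Ordinal jn0))//= lerDl.
exact: sumr_ge0.
Qed.

(** * Limits as t tends to 0 from the right *)

Section asymptotics.
Context (R : realType) (lam : nat -> R) (c : R).
Hypothesis finite_lam : forall x, finite_set [set n | lam n < x].
Hypothesis c0 : 0 < c.
Hypothesis cvg_count : counting_function lam x / x @[x --> +oo] --> c.

Let count_linear (e : R) : 0 < e -> exists2 C : R, 0 <= C &
  forall j, `|counting_function lam j.+1%:R - c * j.+1%:R| <= e * j.+1%:R + C.
Proof.
move=> e0; apply: cvg_seq_linear_bound => //.
have /cvg_pinftyP : counting_function lam x / x @[x --> +oo] --> c by [].
apply; rewrite (cvg_shiftS (fun n => n%:R : R)); exact: cvgr_idn.
Qed.

Let div_one_subr_expRN (t : R) : 0 < t -> 1 <= t / (1 - expR (- t)) <= 1 + t.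
Proof.
move=> t0; have p0 : 0 < 1 - expR (- t) by rewrite subr_gt0 expR_lt1 oppr_lt0.
rewrite ler_pdivlMr// mul1r ler_pdivrMr//.
have := expR_ge1Dx (- t); have := expR_ge1Dx t.
have : expR t * expR (- t) = 1 by rewrite -expRD subrr expR0.
have := expR_gt0 (- t).
set x := expR t; set y := expR (- t); nra.
Qed.

Lemma cvg_mulr_heat_kernel : t * heat_kernel lam t @[t --> 0^'+] --> c.
Proof.
have [L L0 leL] := lam_bounded_below finite_lam.
apply/cvgrPdist_le => e' e'0.
(* Halving leaves room between the limits [c - e], [c + e] and the targets [c - e'], [c + e']; the
   minimum with [c] keeps [c - e] nonnegative, so that [w >= 1] can be used in the lower bound. *)
pose e := Num.min (e' / 2) c.
have e0 : 0 < e by rewrite lt_min c0 divr_gt0.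
have ec : e <= c by rewrite ge_min lexx orbT.
have ee : e <= e' / 2 by rewrite ge_min lexx.
have [C C0 countC] := count_linear e0.
have cvg_id : t @[t --> (0:R)^'+] --> (0 : R) by exact: cvg_at_right_filter.
have cvg_expR (f : R -> R) : f t @[t --> 0^'+] --> (0 : R) ->
    expR (f t) @[t --> 0^'+] --> (1 : R).
  move=> f0; rewrite -(@expR0 R).
  by apply: (cvg_comp _ _ f0); exact: continuous_expR.
have hi : expR (L * t) * ((c + e) * (1 + t) + t * C) @[t --> 0^'+] --> c + e.
  rewrite [X in _ --> X](_ : _ = 1 * ((c + e) * (1 + 0) + 0 * C)); last first.
    by ring.
  apply: cvgM.
    apply: cvg_expR; rewrite -[X in _ --> X](mulr0 L).
    by apply: cvgM => //; exact: cvg_cst.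
  apply: cvgD; last by apply: cvgM => //; exact: cvg_cst.
  by apply: cvgM; [exact: cvg_cst | apply: cvgD => //; exact: cvg_cst].
have lo : expR (- t) * ((c - e) - t * C) @[t --> 0^'+] --> c - e.
  rewrite [X in _ --> X](_ : _ = 1 * ((c - e) - 0 * C)); last by ring.
  apply: cvgM.
    by apply: cvg_expR; rewrite -[X in _ --> X]oppr0; exact: cvgN.
  by apply: cvgB; [exact: cvg_cst | apply: cvgM => //; exact: cvg_cst].
near=> t.
have t0 : 0 < t by [].
have hi_t : expR (L * t) * ((c + e) * (1 + t) + t * C) <= c + e'.
  near: t; apply: (cvgr_le _ hi); lra.
have lo_t : c - e' <= expR (- t) * ((c - e) - t * C).
  near: t; apply: (cvgr_ge _ lo); lra.
set K := heat_kernel lam t.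
have /andP[w1 w2] := div_one_subr_expRN t0.
set w := t / (1 - expR (- t)) in w1 w2.
have partial_le m : series (fun n => expR (- lam n * t)) m <=
    expR (L * t) * ((c + e) / (1 - expR (- t)) + C).
  apply: heat_partial_sum_le => //; first by rewrite addr_ge0// ltW.
  by move=> j; have := countC j; rewrite ler_norml => /andP[_]; lra.
(* [heat_kernel] is a bare [limn], so bounds on partial sums pass to it only once convergence is
   known. *)
have cvgK : cvgn (series (fun n => expR (- lam n * t))).
  apply: nondecreasing_is_cvgn.
    by move=> a b ab; rewrite increasing_series// => n; exact: expR_gt0.
  by exists (expR (L * t) * ((c + e) / (1 - expR (- t)) + C)) => _ [m _ <-].
have K_le : K <= expR (L * t) * ((c + e) / (1 - expR (- t)) + C).
  by apply: limr_le => //; near=> m.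
have K_ge : expR (- t) * ((c - e) / (1 - expR (- t)) - C) <= K.
  apply: heat_kernel_ge => //.
  by move=> j; have := countC j; rewrite ler_norml => /andP[+ _]; lra.
have tK_le : t * K <= c + e'.
  apply: le_trans hi_t; apply: le_trans (ler_wpM2l (ltW t0) K_le) _.
  rewrite mulrCA ler_wpM2l ?expR_ge0// mulrDr lerD2r mulrCA.
  by rewrite ler_wpM2l// addr_ge0// ltW.
have tK_ge : c - e' <= t * K.
  apply: (le_trans lo_t); apply: le_trans (ler_wpM2l (ltW t0) K_ge).
  rewrite mulrCA ler_wpM2l ?expR_ge0// mulrBr lerD2r mulrCA.
  by rewrite ler_peMr// subr_ge0.
by rewrite ler_norml; apply/andP; split; lra.
Unshelve. all: by end_near. Qed.

(** The quotient equals (N(1/t) / (1/t)) / (t K(t)), where both parts tend to the same nonzero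
    [c]. *)
Lemma cvg_count_div_heat_kernel :
  counting_function lam t^-1 / heat_kernel lam t @[t --> 0^'+] --> (1 : R).
Proof.
rewrite -(@divff _ c) ?gt_eqF//.
have : (counting_function lam t^-1 / t^-1) / (t * heat_kernel lam t)
    @[t --> 0^'+] --> c / c.
  apply: cvgM; last first.
    by apply: cvgV; [rewrite gt_eqF | exact: cvg_mulr_heat_kernel].
  apply: (cvg_comp _ _ _ cvg_count).
  apply/(cvgrVy (f := id)); last exact: cvg_at_right_filter.
  by near=> t.
apply: cvg_trans; apply: near_eq_cvg; near=> t.
have t0 : t != 0 by rewrite gt_eqF.
by rewrite invrK invfM -mulrA mulVKf.
Unshelve. all: by end_near. Qed.

End asymptotics.

(** * From a constant density to the two limits *)

Theorem theorem5 (R : realType) (d : nat) (M : topologicalType)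
    (G : riemannian_manifold R d M) (D : set (M -> R)) (lam : nat -> R)
    (rho : R -> R) (c : R)
    (domainD : laplace_domain G D)
    (spectrum_lam : laplace_spectrum G D lam)
    (density_rho : density_of_eigenstates lam rho)
    (rho_constant : forall x, 0 <= x -> rho x = c) :
  counting_function lam x / heat_kernel lam x^-1 @[x --> +oo%R] --> (1 : R) /\
  counting_function lam t^-1 / heat_kernel lam t @[t --> 0^'+] --> (1 : R).
Proof.
have [finite_lam _] := spectrum_lam.
have [_ cvg_rho] := density_rho.
have intE (x : R) : 0 < x ->
    \int[@lebesgue_measure R]_(y in `[0, x]) rho y = c * x.
  move=> x0; rewrite (@eq_Rintegral _ _ _ _ _ (cst c)); last first.
    by move=> y; rewrite inE/= in_itv/= => /andP[y0 _]; exact: rho_constant.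
  by rewrite Rintegral_cst//= lebesgue_measure_itv/= lte_fin x0 oppr0 adde0.
have cvg_c : counting_function lam x / (c * x) @[x --> +oo] --> (1 : R).
  apply: cvg_trans cvg_rho; apply: near_eq_cvg; near=> x.
  by rewrite intE.
(* If [c <= 0], the ratio would be nonpositive for every x > 0 (for [c = 0] division by zero returns
   0), against its limit 1. *)
have c0 : 0 < c.
  have [x [x0 hx]] :
      exists x, 0 < x /\ 2^-1 <= counting_function lam x / (c * x).
    near (+oo : set_system R) => x; exists x; split=> //.
    by near: x; apply: (cvgr_ge _ cvg_c); lra.
  rewrite ltNge; apply/negP => c_le0.
  suff : counting_function lam x / (c * x) <= 0 by lra.
  by rewrite mulr_ge0_le0// invr_le0 mulr_le0_ge0// ltW.
have cvg_count : counting_function lam x / x @[x --> +oo] --> c.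
  have : c * (counting_function lam x / (c * x)) @[x --> +oo] --> c * 1.
    by apply: cvgM => //; exact: cvg_cst.
  rewrite mulr1; apply: cvg_trans; apply: near_eq_cvg; near=> x.
  have x_neq0 : x != 0 by rewrite gt_eqF.
  field.
  by rewrite x_neq0 gt_eqF.
have cvg0 := cvg_count_div_heat_kernel finite_lam c0 cvg_count.
split=> //.
(* The first limit is the second one under t = 1/x, which approaches 0 from the right. *)
have cvg_inv : x^-1 @[x --> +oo] --> (0 : R)^'+.
  have inv0 : x^-1 @[x --> +oo] --> (0 : R).
    by apply/(gtr0_cvgV0 (f := id)) => //; near=> x.
  move=> A /inv0 A0; change (\forall x \near (+oo : set_system R), A x^-1).
  have {}A0 : \forall x \near (+oo : set_system R), 0 < x^-1 -> A x^-1 by [].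
  near=> x; have : 0 < x^-1 by rewrite invr_gt0.
  by near: x.
have := cvg_comp _ _ cvg_inv cvg0.
by rewrite /comp; under eq_fun do rewrite invrK.
Unshelve. all: by end_near. Qed.
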